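(* Let $R$ be a reduced commutative ring with unity having more than two minimal primes. Then $\operatorname{girth} \mathbb{AG}(R) = 3$.
   Context: The annihilating-ideal graph $\mathbb{AG}(R)$ of a commutative ring $R$ is the zero-divisor graph of the semigroup of all ideals of $R$ under ideal multiplication: its vertices are the nonzero ideals $I$ of $R$ such that $IJ=0$ for some nonzero ideal $J$ of $R$, and two distinct vertices $I,J$ are adjacent precisely when $IJ=0$. The girth of a graph is the length of a shortest cycle, or $\infty$ if there are no cycles. *)

(* Defs.v *)
From HB Require Import structures.
From mathcomp Require Import all_boot all_order all_algebra.
From mathcomp Require Import boolp classical_sets functions cardinality.

Set Implicit Arguments.
Unset Strict Implicit.
Unset Printing Implicit Defensive.

Import GRing.Theory.
Local Open Scope classical_set_scope.
Local Open Scope ring_scope.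

(* The structures of ring_quotient.v only cover decidable proper ideals; here
   the whole ring must count as an ideal and no decidability is assumed. *)
Record ideal (R : comPzRingType) := Ideal {
  ideal_set :> R -> Prop;
  ideal_has0 : ideal_set 0;
  ideal_closedD : forall x y, ideal_set x -> ideal_set y -> ideal_set (x + y);
  ideal_closedM : forall a x, ideal_set x -> ideal_set (a * x)
}.

HB.instance Definition _ (R : comPzRingType) := gen_eqMixin (ideal R).

Lemma ideal_ext (R : comPzRingType) (I J : ideal R) :
  ideal_set I = ideal_set J -> I = J.
Proof.
case: I J => [I I0 ID IM] [J J0 JD JM] /= IJ; move: J0 JD JM; rewrite -IJ.
by move=> J0 JD JM; f_equal; apply: Prop_irrelevance.
Qed.

Section IdealOps.
Variable R : comPzRingType.
Implicit Types I J : ideal R.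

Definition ideal0 : ideal R.
Proof.
refine (@Ideal R [set 0] erefl _ _).
- by move=> x y /= -> ->; rewrite addr0.
- by move=> a x /= ->; rewrite mulr0.
Defined.

Definition ideal_mul_set I J : set R :=
  [set x | exists n (a b : 'I_n -> R),
     [/\ forall i, I (a i), forall i, J (b i) & x = \sum_(i < n) a i * b i]].

Definition ideal_mul I J : ideal R.
Proof.
refine (@Ideal R (ideal_mul_set I J) _ _ _).
- have f : 'I_0 -> R by move=> _; exact: 0.
  by exists 0%N, f, f; split=> [[]|[]|] //; rewrite big_ord0.
- move=> _ _ [n [a [b [aI bJ ->]]]] [m [c [d [cI dJ ->]]]].
  exists (n + m)%N.
  exists (fun i => match fintype.split i with inl j => a j | inr j => c j end).
  exists (fun i => match fintype.split i with inl j => b j | inr j => d j end).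
  split=> [i|i|]; try by case: (fintype.split i).
  rewrite big_split_ord; congr (_ + _); apply: eq_bigr => i _.
    by rewrite (unsplitK (inl i)).
  by rewrite (unsplitK (inr i)).
- move=> r _ [n [a [b [aI bJ ->]]]].
  exists n, (fun i => r * a i), b; split=> // [i|].
    exact: ideal_closedM.
  by rewrite mulr_sumr; apply: eq_bigr => i _; rewrite mulrA.
Defined.

Lemma ideal_mulC : commutative ideal_mul.
Proof.
suff sub I J : ideal_mul_set I J `<=` ideal_mul_set J I.
  by move=> I J; apply/ideal_ext/seteqP; split; apply: sub.
move=> _ [n [a [b [aI bJ ->]]]]; exists n, b, a; split=> //.
by apply: eq_bigr => i _; rewrite mulrC.
Qed.

End IdealOps.

Definition reduced (R : comPzRingType) : Prop :=
  forall (x : R) (n : nat), x ^+ n = 0 -> x = 0.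

Definition prime_ideal (R : comPzRingType) (P : ideal R) : Prop :=
  ~ P 1 /\ forall x y : R, P (x * y) -> P x \/ P y.

Definition minimal_primes (R : comPzRingType) : set (ideal R) :=
  [set P | prime_ideal P /\
           forall Q : ideal R, prime_ideal Q -> ideal_set Q `<=` ideal_set P -> Q = P].
Arguments minimal_primes : clear implicits.

Record sgraph := SGraph {
  vertex :> eqType;
  adj : rel vertex;
  adj_sym : symmetric adj;
  adj_irrefl : irreflexive adj
}.

Definition has_cycle (G : sgraph) (n : nat) : bool :=
  `[< exists c : seq G, [/\ size c = n, (2 < n)%N & ucycle (@adj G) c] >].

(* None stands for infinite girth. *)
Definition girth (G : sgraph) : option nat :=
  if pselect (exists n, has_cycle G n) is left exc then Some (ex_minn exc)
  else None.

Section AnnihilatingIdealGraph.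
Variable R : comPzRingType.

Definition AG_vertex : pred (ideal R) := fun I =>
  `[< I <> ideal0 R /\
      exists J : ideal R, J <> ideal0 R /\ ideal_mul I J = ideal0 R >].

Definition AG_adj : rel {I : ideal R | AG_vertex I} := fun I J =>
  (I != J) && (ideal_mul (val I) (val J) == ideal0 R).

Lemma AG_sym : symmetric AG_adj.
Proof. by move=> I J; rewrite /AG_adj eq_sym ideal_mulC. Qed.

Lemma AG_irrefl : irreflexive AG_adj.
Proof. by move=> I; rewrite /AG_adj eqxx. Qed.

Definition AG : sgraph := SGraph AG_sym AG_irrefl.

End AnnihilatingIdealGraph.
Arguments AG : clear implicits.

(* Main.v *)
Require Import Defs.
From mathcomp Require Import all_boot all_order all_algebra.
From mathcomp Require Import boolp classical_sets functions cardinality.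
Local Open Scope classical_set_scope.
Local Open Scope card_scope.

(** A minimal prime [P] of a reduced ring consists of zero divisors in a strong
sense: every [x] in [P] is killed by some [s] outside [P]
([minimal_prime_annihilator]).  Otherwise the products [s * x ^+ n] with [s]
outside [P] would form a multiplicative set avoiding 0, and Krull's lemma
([prime_avoiding]) would give a prime missing both [x] and the complement of
[P], hence strictly below [P].

Consequently two distinct minimal primes [P] and [Q] have disjoint
neighbourhoods in the minimal spectrum: if [a] lies in [P] but not in [Q], and
[s] outside [P] kills [a], then [s * a = 0] with [s] outside [P] and [a] outside
[Q].  Multiplying such elements over all pairs turns any finite family of
distinct minimal primes [P i] into pairwise annihilating elements [x i] outside
[P i] ([annihilating_family]).  With three primes, the principal ideals
generated by the [x i] form a triangle: they are nonzero, their pairwise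
products vanish, and they are distinct because a nonzero ideal of a reduced ring
has a nonzero square.  A triangle is the shortest possible cycle. *)

Set Implicit Arguments.
Unset Strict Implicit.

Import GRing.Theory.
Local Open Scope ring_scope.

(** * Primes avoiding a multiplicative set *)

Section Krull.
Variable R : comPzRingType.
Implicit Types (P Q : ideal R) (x y : R).

(** Krull's lemma: an ideal maximal among those disjoint from [S] is prime. *)
Lemma prime_avoiding (S : set R) :
  S 1 -> (forall x y, S x -> S y -> S (x * y)) -> ~ S 0 ->
  exists2 Q, prime_ideal Q & forall x, S x -> ~ Q x.
Proof.
move=> S1 SM S0.
(* Membership of 0 is left out so that the empty chain has an upper bound; it
   is recovered from maximality. *)
pose T (A : set R) := [/\ forall x y, A x -> A y -> A (x + y),
  forall a x, A x -> A (a * x) & forall x, S x -> ~ A x].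
have [|A [[AD AM AS] Amax]] := @Zorn_bigcup R T.
  move=> F FT Ftot; split.
  - move=> x y [B FB Bx] [C FC Cy].
    have [BC|CB] := Ftot _ _ FB FC.
      by exists C => //; have [CD _ _] := FT _ FC; apply: CD => //; apply: BC.
    by exists B => //; have [BD _ _] := FT _ FB; apply: BD => //; apply: CB.
  - by move=> a x [B FB Bx]; exists B => //; have [_ BM _] := FT _ FB; apply: BM.
  - by move=> x Sx [B FB Bx]; have [_ _ BS] := FT _ FB; apply: (BS x).
have A0 : A 0.
  apply: contrapT => nA0.
  have T0 : T [set 0].
    split=> [x y /= -> ->|a x /= ->|x Sx /= x0]; rewrite ?addr0 ?mulr0 //.
    by rewrite x0 in Sx.
  apply: Amax T0; split=> [x Ax|]; first by case: nA0; rewrite -(mul0r x); apply: AM.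
  by move=> /(_ 0 erefl).
have meetS x : ~ A x -> exists a r, A a /\ S (a + r * x).
  move=> nAx; apply: contrapT => noS.
  apply: (Amax [set z | exists a r, A a /\ z = a + r * x]).
    split=> [z Az|sub]; first by exists z, 0; rewrite mul0r addr0.
    by apply/nAx/sub; exists 0, 1; rewrite mul1r add0r.
  split.
  - move=> _ _ [a [r [Aa ->]]] [b [t [Ab ->]]].
    by exists (a + b), (r + t); split; [apply: AD | rewrite mulrDl addrACA].
  - move=> c _ [a [r [Aa ->]]].
    by exists (c * a), (c * r); split; [apply: AM | rewrite mulrDr mulrA].
  - by move=> z Sz [a [r [Aa zE]]]; apply: noS; exists a, r; rewrite -zE.
exists (Ideal A0 AD AM) => //; split; first exact: (AS 1).
move=> x y /= Axy; apply: contrapT => /not_orP[/meetS[a [r [Aa Sax]]]].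
move=> /meetS[b [t [Ab Sby]]]; apply: (AS _ (SM _ _ Sax Sby)).
rewrite mulrDl; apply: (AD); first by rewrite mulrC; apply: (AM).
rewrite mulrDr; apply: (AD); first exact: (AM).
by rewrite mulrACA; apply: (AM).
Qed.

(** * Separating minimal primes *)

Lemma prime_idealMN P x y : prime_ideal P -> ~ P x -> ~ P y -> ~ P (x * y).
Proof. by move=> [_ Pp] Px Py /Pp[]. Qed.

(** Minimality enters through Krull's lemma: a prime avoiding every
[s * x ^+ n] with [s] outside [P] is contained in [P] (take [n = 0]), hence is
[P], yet it misses [x] (take [s = 1]).  So 0 is one of these products, and
reducedness lowers the exponent to 1. *)
Lemma minimal_prime_annihilator P x :
  reduced R -> minimal_primes R P -> P x -> exists2 s, ~ P s & s * x = 0.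
Proof.
move=> redR [Pp Pmin] Px.
pose S := [set z | exists s n, ~ P s /\ z = s * x ^+ n].
have [[s [n [Ps sx0]]]|nS0] := pselect (S 0).
  (* The exponent is raised to [n.+1] to cover [n = 0]. *)
  exists s => //; apply: (redR _ n.+1).
  by rewrite exprMn exprSr [x ^+ n.+1]exprS mulrACA -sx0 mulr0.
have [||Q Qp QS] := @prime_avoiding S _ _ nS0.
- by exists 1, 0%N; rewrite mul1r; split=> //; case: Pp.
- move=> _ _ [s [n [Ps ->]]] [t [m [Pt ->]]]; exists (s * t), (n + m)%N.
  by rewrite exprD mulrACA; split=> //; apply: prime_idealMN.
have QP : ideal_set Q `<=` ideal_set P.
  move=> z Qz; apply: contrapT => Pz; apply: QS Qz.
  by exists z, 0%N; rewrite mulr1.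
have PE := Pmin Q Qp QP; subst Q.
by case: (QS x) => //; exists 1, 1%N; rewrite mul1r; split=> //; case: Pp.
Qed.

Lemma minimal_primes_separated P Q :
  reduced R -> minimal_primes R P -> minimal_primes R Q -> P <> Q ->
  exists ab : R * R, [/\ ~ P ab.1, ~ Q ab.2 & ab.1 * ab.2 = 0].
Proof.
move=> redR Pm Qm PQ.
have [a Pa Qa] : exists2 a, P a & ~ Q a.
  apply: contrapT => noa; apply: PQ; apply: Qm.2; first exact: Pm.1.
  by move=> a Pa; apply: contrapT => Qa; apply: noa; exists a.
by have [s Ps sa0] := minimal_prime_annihilator redR Pm Pa; exists (s, a).
Qed.

Lemma annihilating_family (I : finType) (P : I -> ideal R) :
  reduced R -> injective P -> (forall i, minimal_primes R (P i)) ->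
  exists x : I -> R,
    (forall i, ~ P i (x i)) /\ (forall i j, i != j -> x i * x j = 0).
Proof.
move=> redR Pinj Pm.
have /choice[g gP] (ij : I * I) : exists ab : R * R, ij.1 != ij.2 ->
    [/\ ~ P ij.1 ab.1, ~ P ij.2 ab.2 & ab.1 * ab.2 = 0].
  have [_|ij_neq] := eqVneq ij.1 ij.2; first by exists (0, 0).
  have [|ab abP] := minimal_primes_separated redR (Pm ij.1) (Pm ij.2).
    by move=> /Pinj /eqP; apply/negP.
  by exists ab.
(* Both choices made for the unordered pair [i, j] enter, so that [a i j] and
   [a j i] annihilate each other. *)
pose a i j := (g (i, j)).1 * (g (j, i)).2.
have aP i j : i != j -> ~ P i (a i j).
  move=> ij; have [/= Pi _ _] := gP (i, j) ij.
  have [|/= _ Pi' _] := gP (j, i); first by rewrite eq_sym.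
  by apply: prime_idealMN => //; case: (Pm i).
have aa0 i j : i != j -> a i j * a j i = 0.
  move=> ij; have [/= _ _ g0] := gP (i, j) ij.
  by rewrite /a [X in _ * X]mulrC mulrACA g0 mul0r.
exists (fun i => \prod_(j | j != i) a i j); split=> [i|i j ij].
  apply: (big_ind (fun z => ~ P i z)); first by case: (Pm i) => -[].
    by move=> x y; apply: prime_idealMN; case: (Pm i).
  by move=> j ji; apply: aP; rewrite eq_sym.
have ji : j != i by rewrite eq_sym.
by rewrite (bigD1 j ji) [X in _ * X](bigD1 i ij) /= mulrACA aa0 // mul0r.
Qed.

(** * Triangles of principal ideals *)

Definition principal_ideal x : ideal R.
Proof.
refine (@Ideal R [set z | exists r, z = r * x] _ _ _).
- by exists 0; rewrite mul0r.
- by move=> _ _ [r ->] [t ->]; exists (r + t); rewrite mulrDl.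
- by move=> a _ [r ->]; exists (a * r); rewrite mulrA.
Defined.

Lemma principal_ideal_gen x : principal_ideal x x.
Proof. by exists 1; rewrite mul1r. Qed.

Lemma principal_ideal_neq0 x : x <> 0 -> principal_ideal x <> ideal0 R.
Proof. by move=> x0 xE; apply: x0; have := principal_ideal_gen x; rewrite xE. Qed.

Lemma principal_ideal_mul0 x y :
  x * y = 0 -> ideal_mul (principal_ideal x) (principal_ideal y) = ideal0 R.
Proof.
move=> xy0; apply/ideal_ext/seteqP; split=> z /=.
  move=> [n [a [b [aI bJ ->]]]]; apply: big1 => i _.
  by have [r ->] := aI i; have [t ->] := bJ i; rewrite mulrACA xy0 mulr0.
by move=> ->; apply: (ideal_has0 (ideal_mul _ _)).
Qed.

Lemma AG_vertex_principal x y :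
  x <> 0 -> y <> 0 -> x * y = 0 -> AG_vertex (principal_ideal x).
Proof.
move=> x0 y0 xy0; apply/asboolP; split; first exact: principal_ideal_neq0.
exists (principal_ideal y); split; first exact: principal_ideal_neq0.
exact: principal_ideal_mul0.
Qed.

(** If the two ideals coincided, [x] would be a multiple of [y], so that
[x ^+ 2 = 0]. *)
Lemma AG_adj_principal (u v : AG R) x y :
  reduced R -> val u = principal_ideal x -> val v = principal_ideal y ->
  x <> 0 -> x * y = 0 -> adj u v.
Proof.
move=> redR uE vE x0 xy0; apply/andP; split; last first.
  by apply/eqP; rewrite uE vE; apply: principal_ideal_mul0.
apply/eqP => uv; apply: x0; apply: (redR _ 2%N).
have [r xE] : principal_ideal y x by rewrite -vE -uv uE; apply: principal_ideal_gen.
by rewrite expr2 {2}xE mulrCA xy0 mulr0.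
Qed.

End Krull.

Lemma girth_triangle (G : sgraph) (u v w : G) :
  adj u v -> adj v w -> adj w u -> girth G = Some 3%N.
Proof.
move=> uv vw wu.
have neq (a b : G) : adj a b -> a != b.
  by move=> ab; apply/eqP => abE; rewrite abE adj_irrefl in ab.
have cyc3 : has_cycle G 3.
  apply/asboolP; exists [:: u; v; w]; split=> //; apply/andP; split.
    by rewrite /= uv vw wu.
  by rewrite /= !inE negb_or (neq _ _ uv) (neq _ _ vw) eq_sym (neq _ _ wu).
rewrite /girth; case: pselect => [exc|[]]; last by exists 3%N.
congr Some; case: ex_minnP => n /asboolP[c [_ n_gt2 _]] n_min.
by apply/eqP; rewrite eqn_leq n_min.
Qed.

Lemma card_le_I_inj (T : Type) (A : set T) n :
  `I_n #<= A -> exists2 f : 'I_n -> T, injective f & forall i, A (f i).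
Proof.
move=> /card_leP[f].
pose k (i : 'I_n) : `I_n := SigSub (mem_set (ltn_ord i : `I_n i)).
exists (fun i => val (f (k i))) => [i j|i]; last exact/set_mem/valP.
move=> /val_inj /(@inj _ _ _ f _ _ (mem_set I) (mem_set I)) kij.
exact/val_inj/(congr1 val kij).
Qed.

Unset Implicit Arguments.

Theorem theorem4p5 (R : comPzRingType) (redR : reduced R)
    (minR : `I_3 #<= minimal_primes R) :
  girth (AG R) = Some 3%N.
Proof.
have [P Pinj Pm] := card_le_I_inj minR.
have [x [xP xx0]] := annihilating_family redR Pinj Pm.
have x0 i : x i <> 0 by move=> xi0; apply: (xP i); rewrite xi0; apply: ideal_has0.
have xV i j : i != j -> AG_vertex (principal_ideal (x i)).
  by move=> ij; apply: (@AG_vertex_principal _ _ (x j)) => //; apply: xx0.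
pose i0 : 'I_3 := ord0; pose i1 : 'I_3 := inord 1; pose i2 : 'I_3 := ord_max.
have [n01 n12 n20] : [/\ i0 != i1, i1 != i2 & i2 != i0].
  by split; rewrite -val_eqE /= ?inordK.
apply: (@girth_triangle (AG R) (Sub _ (xV _ _ n01)) (Sub _ (xV _ _ n12))
  (Sub _ (xV _ _ n20))).
- by apply: (@AG_adj_principal _ _ _ (x i0) (x i1)) => //; apply: xx0.
- by apply: (@AG_adj_principal _ _ _ (x i1) (x i2)) => //; apply: xx0.
- by apply: (@AG_adj_principal _ _ _ (x i2) (x i0)) => //; apply: xx0.
Qed.
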